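(* Let $g: R \to R'$ be a homomorphism of commutative unital rings and let $x \in R$ be such that $x$ is a non-zero-divisor in $R$ and $g(x)$ is a non-zero-divisor in $R'$. Consider the principal localization square $$\mathcal{F}_{loc}:\qquad \begin{array}{ccc} R & \to & R_x \\ {\scriptstyle g}\downarrow & & \downarrow{\scriptstyle g_x} \\ R' & \to & R'_{g(x)}. \end{array}$$ Suppose that $R/(x)$ is a (nonzero) Euclidean domain. Then the following are equivalent: (1) the induced map $\bar g: R/(x) \to R'/(g(x))$ is injective and identifies $R'/(g(x))$ with some subring of the fraction field $k(R/(x))$ containing $R/(x)$ (that is, there is an injective ring homomorphism $\iota: R'/(g(x)) \to k(R/(x))$ such that $\iota \circ \bar g$ is the canonical inclusion $R/(x) \hookrightarrow k(R/(x))$); (2) $\mathcal{F}_{loc}$ is a strong Milnor patching diagram.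
   Context: All rings are commutative and unital. $R_x = R[1/x]$ denotes localization at the powers of $x$, and $g_x: R_x \to R'_{g(x)}$ is the map induced by $g$; horizontal maps in the square are the localization maps. $k(D)$ denotes the fraction field of a domain $D$. Let $\mathcal{F}$ be a commutative square of rings with maps $g_1: R \to R_1$, $g_2: R \to R_2$, $h_1: R_1 \to S$, $h_2: R_2 \to S$, $h_1 g_1 = h_2 g_2$. The square is cartesian if the sequence $0 \to R \xrightarrow{\varphi} R_1 \oplus R_2 \xrightarrow{\psi} S$ is exact, where $\varphi(r) = (g_1(r), g_2(r))$ and $\psi(r_1, r_2) = h_1(r_1) - h_2(r_2)$. The square is a strong Milnor patching diagram if it is cartesian and for every $n\ge 1$ and every $A_S \in \mathrm{GL}_n(S)$ there are $A_1 \in \mathrm{GL}_{2n}(R_1)$, $A_2 \in \mathrm{GL}_{2n}(R_2)$ such that $$\begin{pmatrix} A_S & 0 \\ 0 & A_S^{-1} \end{pmatrix} = h_1(A_1) h_2(A_2),$$ where ring homomorphisms are applied to matrices entrywise. For $\mathcal{F}_{loc}$ one takes $R_1 = R_x$, $R_2 = R'$, $S = R'_{g(x)}$, $h_1=g_x$. *)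

(* Defs.v *)
From HB Require Import structures.
From mathcomp Require Import all_boot ssralg matrix ring.
From mathcomp Require Import generic_quotient ring_quotient fraction.
From mathcomp Require Import boolp.

Set Implicit Arguments.
Unset Strict Implicit.
Unset Printing Implicit Defensive.

Import GRing.Theory.
Local Open Scope ring_scope.
Local Open Scope quotient_scope.

(* Rings are [comPzRingType]s, so the zero ring is allowed: pquot (g x) and the
   localizations below may be zero. *)

Definition non_zero_divisor (R : comPzRingType) (x : R) : Prop :=
  forall y : R, x * y = 0 -> y = 0.

(* The library only quotients a ring by a proper ideal; the ring structure on
   the Z-module quotient is built here for an arbitrary principal ideal. *)

Section PrincipalQuotient.
Variables (R : comPzRingType) (x : R).

Definition principal (a : R) : bool := `[< exists c : R, a = x * c >].

Lemma principalP a : reflect (exists c : R, a = x * c) (a \in principal).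
Proof. exact: asboolP. Qed.

Fact principal_zmod_closed : zmod_closed principal.
Proof.
split; first by apply/principalP; exists 0; rewrite mulr0.
move=> a b /principalP[c ->] /principalP[d ->].
by apply/principalP; exists (c - d); rewrite mulrBr.
Qed.

HB.instance Definition _ :=
  GRing.isZmodClosed.Build R principal principal_zmod_closed.

Definition pquot : Type := {ideal_quot (GRing.ZmodClosed.clone R principal _)}.

HB.instance Definition _ := GRing.Zmodule.on pquot.
HB.instance Definition _ := EqQuotient.on pquot.
HB.instance Definition _ :=
  ZmodQuotient.copy pquot {ideal_quot (GRing.ZmodClosed.clone R principal _)}.

Lemma pquot_eqP (a b : R) :
  reflect (exists c, a - b = x * c) (a == b %[mod pquot]).
Proof. by rewrite -[X in reflect _ X]Quotient.idealrBE; exact: principalP. Qed.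

Definition pquot_one : pquot := lift_cst pquot 1.
Definition pquot_mul := lift_op2 pquot *%R.

Canonical pquot_pi_one := PiConst pquot_one.

Fact pquot_pi_mul : {morph \pi_pquot : a b / a * b >-> pquot_mul a b}.
Proof.
move=> a b; unlock pquot_mul; apply/eqP/pquot_eqP.
have /pquot_eqP[c hc] : a == repr (\pi_pquot a) %[mod pquot] by rewrite reprK.
have /pquot_eqP[d hd] : b == repr (\pi_pquot b) %[mod pquot] by rewrite reprK.
set a' := repr _ in hc *; set b' := repr _ in hd *.
exists (c * b + a' * d).
by rewrite mulrDr mulrA -hc mulrCA -hd mulrBl mulrBr addrA subrK.
Qed.
Canonical pquot_pi_mul_morph := PiMorph2 pquot_pi_mul.

Fact pquot_mulA : associative pquot_mul.
Proof. by do 3!elim/quotW=> ?; rewrite !piE mulrA. Qed.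

Fact pquot_mulC : commutative pquot_mul.
Proof. by do 2!elim/quotW=> ?; rewrite !piE mulrC. Qed.

Fact pquot_mul1 : left_id pquot_one pquot_mul.
Proof. by elim/quotW=> ?; rewrite !piE mul1r. Qed.

Fact pquot_mulDl : left_distributive pquot_mul +%R.
Proof.
elim/quotW=> a; elim/quotW=> b; elim/quotW=> c.
by rewrite -raddfD -!pquot_pi_mul -raddfD mulrDl.
Qed.

HB.instance Definition _ := GRing.Zmodule_isComPzRing.Build pquot
  pquot_mulA pquot_mulC pquot_mul1 pquot_mulDl.

Definition to_pquot (a : R) : pquot := \pi_pquot a.

Lemma to_pquot_eqP (a b : R) :
  to_pquot a = to_pquot b <-> exists c, a - b = x * c.
Proof. by split=> [/eqP/pquot_eqP|h] //; apply/eqP/pquot_eqP. Qed.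

Lemma to_pquotW (P : pquot -> Prop) : (forall a, P (to_pquot a)) -> forall u, P u.
Proof. by move=> h; elim/quotW; exact: h. Qed.

Fact to_pquot_zmod_morphism : zmod_morphism to_pquot.
Proof. by move=> a b; rewrite /to_pquot raddfB. Qed.

Fact to_pquot_monoid_morphism : monoid_morphism to_pquot.
Proof.
split=> [|a b]; last by rewrite /to_pquot pquot_pi_mul.
exact: (lock (\pi_pquot 1 : pquot)).
Qed.

HB.instance Definition _ :=
  GRing.isZmodMorphism.Build R pquot to_pquot to_pquot_zmod_morphism.
HB.instance Definition _ :=
  GRing.isMonoidMorphism.Build R pquot to_pquot to_pquot_monoid_morphism.

End PrincipalQuotient.

Section QuotientMap.
Variables (R R' : comPzRingType) (g : {rmorphism R -> R'}) (x : R).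

Definition pquot_map (u : pquot x) : pquot (g x) := to_pquot (g x) (g (repr u)).

Lemma pquot_mapE (a : R) : pquot_map (to_pquot x a) = to_pquot (g x) (g a).
Proof.
apply/to_pquot_eqP; have /to_pquot_eqP[c hc] : to_pquot x (repr (to_pquot x a)) =
  to_pquot x a by rewrite /to_pquot reprK.
by exists (g c); rewrite -rmorphB hc rmorphM.
Qed.

Fact pquot_map_zmod_morphism : zmod_morphism pquot_map.
Proof.
elim/to_pquotW=> a; elim/to_pquotW=> b.
by rewrite -rmorphB !pquot_mapE !rmorphB.
Qed.

Fact pquot_map_monoid_morphism : monoid_morphism pquot_map.
Proof.
split; first by rewrite -(rmorph1 (to_pquot x)) pquot_mapE !rmorph1.
by elim/to_pquotW=> a; elim/to_pquotW=> b; rewrite -rmorphM !pquot_mapE !rmorphM.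
Qed.

HB.instance Definition _ :=
  GRing.isZmodMorphism.Build (pquot x) (pquot (g x)) pquot_map
    pquot_map_zmod_morphism.
HB.instance Definition _ :=
  GRing.isMonoidMorphism.Build (pquot x) (pquot (g x)) pquot_map
    pquot_map_monoid_morphism.

End QuotientMap.

(* R[1/x]: the pair (a, n) stands for a / x ^+ n. *)

Section Localization.
Variables (R : comPzRingType) (x : R).
Implicit Types u v w : R * nat.

Definition loc_rel u v : bool :=
  `[< exists k : nat, x ^+ k * (u.1 * x ^+ v.2 - v.1 * x ^+ u.2) = 0 >].

Lemma loc_relP u v :
  reflect (exists k, x ^+ k * (u.1 * x ^+ v.2) = x ^+ k * (v.1 * x ^+ u.2))
          (loc_rel u v).
Proof.
apply: (iffP (asboolP _)) => -[k hk]; exists k.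
  by apply/eqP; rewrite -subr_eq0 -mulrBr hk.
by rewrite mulrBr hk subrr.
Qed.

Fact loc_rel_equiv : equiv_class_of loc_rel.
Proof.
split=> [u|u v|v u w].
- by apply/loc_relP; exists 0%N.
- by apply/loc_relP/loc_relP => -[k hk]; exists k.
move=> /loc_relP[k hk] /loc_relP[l hl]; apply/loc_relP.
exists (k + l + v.2)%N.
transitivity (x ^+ l * x ^+ w.2 * (x ^+ k * (u.1 * x ^+ v.2))); first by rewrite ?exprD; ring.
rewrite hk.
transitivity (x ^+ k * x ^+ u.2 * (x ^+ l * (v.1 * x ^+ w.2))); first by rewrite ?exprD; ring.
by rewrite hl ?exprD; ring.
Qed.

Canonical loc_rel_eqrel := EquivRelPack loc_rel_equiv.
Canonical loc_rel_encModRel := defaultEncModRel loc_rel.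

Definition loc : Type := {eq_quot loc_rel}.

HB.instance Definition _ : EqQuotient _ loc_rel loc := EqQuotient.on loc.
HB.instance Definition _ := Choice.on loc.

Lemma loc_eqP u v :
  reflect (exists k, x ^+ k * (u.1 * x ^+ v.2) = x ^+ k * (v.1 * x ^+ u.2))
          (u == v %[mod loc]).
Proof. by rewrite eqmodE; exact: loc_relP. Qed.

Lemma loc_repr u :
  exists k, x ^+ k * (u.1 * x ^+ (repr (\pi_loc u)).2) =
            x ^+ k * ((repr (\pi_loc u)).1 * x ^+ u.2).
Proof. by apply/loc_eqP; rewrite reprK. Qed.

Definition loc_frac (a : R) (n : nat) : loc := \pi_loc (a, n).

Definition loc_add_rep u v := (u.1 * x ^+ v.2 + v.1 * x ^+ u.2, (u.2 + v.2)%N).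
Definition loc_opp_rep u := (- u.1, u.2).
Definition loc_mul_rep u v := (u.1 * v.1, (u.2 + v.2)%N).

Definition loc_zero : loc := lift_cst loc (0, 0%N).
Definition loc_one : loc := lift_cst loc (1, 0%N).
Definition loc_add := lift_op2 loc loc_add_rep.
Definition loc_opp := lift_op1 loc loc_opp_rep.
Definition loc_mul := lift_op2 loc loc_mul_rep.

Canonical loc_pi_zero := PiConst loc_zero.
Canonical loc_pi_one := PiConst loc_one.

Fact loc_pi_add : {morph \pi_loc : u v / loc_add_rep u v >-> loc_add u v}.
Proof.
move=> u v; unlock loc_add; apply/eqP/loc_eqP => /=.
have [k] := loc_repr u; have [l] := loc_repr v.
set u' := repr _ => hl; set v' := repr _ => hk.
exists (k + l)%N.
transitivity (x ^+ l * x ^+ v.2 * x ^+ u'.2 * (x ^+ k * (u.1 * x ^+ v'.2))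
            + x ^+ k * x ^+ u.2 * x ^+ v'.2 * (x ^+ l * (v.1 * x ^+ u'.2))).
  by rewrite ?exprD; ring.
by rewrite hk hl ?exprD; ring.
Qed.
Canonical loc_pi_add_morph := PiMorph2 loc_pi_add.

Fact loc_pi_opp : {morph \pi_loc : u / loc_opp_rep u >-> loc_opp u}.
Proof.
move=> u; unlock loc_opp; apply/eqP/loc_eqP => /=.
have [k hk] := loc_repr u; exists k.
by rewrite !mulNr !mulrN hk.
Qed.
Canonical loc_pi_opp_morph := PiMorph1 loc_pi_opp.

Fact loc_pi_mul : {morph \pi_loc : u v / loc_mul_rep u v >-> loc_mul u v}.
Proof.
move=> u v; unlock loc_mul; apply/eqP/loc_eqP => /=.
have [k] := loc_repr u; have [l] := loc_repr v.
set u' := repr _ => hl; set v' := repr _ => hk.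
exists (k + l)%N.
transitivity ((x ^+ k * (u.1 * x ^+ v'.2)) * (x ^+ l * (v.1 * x ^+ u'.2))).
  by rewrite ?exprD; ring.
by rewrite hk hl ?exprD; ring.
Qed.
Canonical loc_pi_mul_morph := PiMorph2 loc_pi_mul.

Fact loc_addA : associative loc_add.
Proof.
do 3!elim/quotW=> ?; rewrite !piE; congr (\pi); rewrite /loc_add_rep /=.
by congr (_, _); [rewrite ?exprD; ring | rewrite addnA].
Qed.

Fact loc_addC : commutative loc_add.
Proof.
do 2!elim/quotW=> ?; rewrite !piE; congr (\pi); rewrite /loc_add_rep /=.
by congr (_, _); [rewrite addrC | rewrite addnC].
Qed.

Fact loc_add0 : left_id loc_zero loc_add.
Proof.
elim/quotW=> -[a n]; rewrite !piE; congr (\pi); rewrite /loc_add_rep /=.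
by rewrite mul0r add0r expr0 mulr1.
Qed.

Fact loc_addN : left_inverse loc_zero loc_opp loc_add.
Proof.
elim/quotW=> -[a n]; rewrite !piE; apply/eqP/loc_eqP; exists 0%N => /=.
by rewrite ?exprD; ring.
Qed.

HB.instance Definition _ := GRing.isZmodule.Build loc
  loc_addA loc_addC loc_add0 loc_addN.

Fact loc_mulA : associative loc_mul.
Proof. by do 3!elim/quotW=> ?; rewrite !piE /loc_mul_rep /= mulrA addnA. Qed.

Fact loc_mulC : commutative loc_mul.
Proof.
by do 2!elim/quotW=> ?; rewrite !piE /loc_mul_rep /= mulrC addnC.
Qed.

Fact loc_mul1 : left_id loc_one loc_mul.
Proof. by elim/quotW=> -[a n]; rewrite !piE /loc_mul_rep /= mul1r. Qed.

Fact loc_mulDl : left_distributive loc_mul loc_add.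
Proof.
elim/quotW=> u; elim/quotW=> v; elim/quotW=> w.
by rewrite !piE; apply/eqP/loc_eqP; exists 0%N; rewrite /= ?exprD; ring.
Qed.

HB.instance Definition _ := GRing.Zmodule_isComPzRing.Build loc
  loc_mulA loc_mulC loc_mul1 loc_mulDl.

Lemma loc_fracD a m b n :
  loc_frac a m + loc_frac b n = loc_frac (a * x ^+ n + b * x ^+ m) (m + n).
Proof. by rewrite /loc_frac -[LHS]loc_pi_add. Qed.

Lemma loc_fracN a m : - loc_frac a m = loc_frac (- a) m.
Proof. by rewrite /loc_frac -[LHS]loc_pi_opp. Qed.

Lemma loc_fracM a m b n : loc_frac a m * loc_frac b n = loc_frac (a * b) (m + n).
Proof. by rewrite /loc_frac -[LHS]loc_pi_mul. Qed.

Lemma loc_frac1 : loc_frac 1 0 = 1.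
Proof. by rewrite /loc_frac [RHS]piE. Qed.

Lemma loc_frac_eqP a m b n :
  loc_frac a m = loc_frac b n <->
  exists k, x ^+ k * (a * x ^+ n) = x ^+ k * (b * x ^+ m).
Proof. by split=> [/eqP/loc_eqP|h] //; apply/eqP/loc_eqP. Qed.

Lemma loc_fracW (P : loc -> Prop) :
  (forall a n, P (loc_frac a n)) -> forall q, P q.
Proof. by move=> h; elim/quotW=> -[a n]; exact: h. Qed.

Definition to_loc (a : R) : loc := loc_frac a 0.

Fact to_loc_zmod_morphism : zmod_morphism to_loc.
Proof.
by move=> a b; rewrite /to_loc loc_fracN loc_fracD !expr0 !mulr1.
Qed.

Fact to_loc_monoid_morphism : monoid_morphism to_loc.
Proof.
split; first exact: loc_frac1.
by move=> a b; rewrite /to_loc loc_fracM.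
Qed.

HB.instance Definition _ :=
  GRing.isZmodMorphism.Build R loc to_loc to_loc_zmod_morphism.
HB.instance Definition _ :=
  GRing.isMonoidMorphism.Build R loc to_loc to_loc_monoid_morphism.

End Localization.

Section LocalizationMap.
Variables (R R' : comPzRingType) (g : {rmorphism R -> R'}) (x : R).

Definition loc_map (u : loc x) : loc (g x) :=
  loc_frac (g x) (g (repr u).1) (repr u).2.

Lemma loc_mapE (a : R) (n : nat) :
  loc_map (loc_frac x a n) = loc_frac (g x) (g a) n.
Proof.
apply/loc_frac_eqP; have [k /= hk] := loc_repr x (a, n).
by exists k; rewrite -!rmorphXn -!rmorphM /loc_frac hk.
Qed.

Fact loc_map_zmod_morphism : zmod_morphism loc_map.
Proof.
elim/loc_fracW=> a m; elim/loc_fracW=> b n.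
rewrite loc_fracN loc_fracD !loc_mapE loc_fracN loc_fracD.
by rewrite rmorphD !rmorphM !rmorphXn rmorphN.
Qed.

Fact loc_map_monoid_morphism : monoid_morphism loc_map.
Proof.
split; first by rewrite -!loc_frac1 loc_mapE rmorph1.
elim/loc_fracW=> a m; elim/loc_fracW=> b n.
by rewrite loc_fracM !loc_mapE loc_fracM rmorphM.
Qed.

HB.instance Definition _ :=
  GRing.isZmodMorphism.Build (loc x) (loc (g x)) loc_map loc_map_zmod_morphism.
HB.instance Definition _ :=
  GRing.isMonoidMorphism.Build (loc x) (loc (g x)) loc_map
    loc_map_monoid_morphism.

End LocalizationMap.

Record square := Square {
  sq_R : comPzRingType;
  sq_R1 : comPzRingType;
  sq_R2 : comPzRingType;
  sq_S : comPzRingType;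
  sq_g1 : {rmorphism sq_R -> sq_R1};
  sq_g2 : {rmorphism sq_R -> sq_R2};
  sq_h1 : {rmorphism sq_R1 -> sq_S};
  sq_h2 : {rmorphism sq_R2 -> sq_S};
  sq_comm : forall r, sq_h1 (sq_g1 r) = sq_h2 (sq_g2 r)
}.

Definition sq_phi (F : square) (r : sq_R F) : sq_R1 F * sq_R2 F :=
  (sq_g1 F r, sq_g2 F r).

Definition sq_psi (F : square) (p : sq_R1 F * sq_R2 F) : sq_S F :=
  sq_h1 F p.1 - sq_h2 F p.2.

Definition cartesian (F : square) : Prop :=
  injective (@sq_phi F) /\
  (forall p, sq_psi p = 0 <-> exists r, @sq_phi F r = p).

(* [unitmx] and [invmx] need a [comUnitRingType], hence the pairs of
   mutually inverse matrices. *)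
Definition inverse_mx (R : comPzRingType) (n : nat) (A B : 'M[R]_n) : Prop :=
  A *m B = 1%:M /\ B *m A = 1%:M.

Definition in_GL (R : comPzRingType) (n : nat) (A : 'M[R]_n) : Prop :=
  exists B, inverse_mx A B.

Definition strong_milnor_patching (F : square) : Prop :=
  cartesian F /\
  forall (n : nat) (A B : 'M[sq_S F]_n), (0 < n)%N -> inverse_mx A B ->
  exists (A1 : 'M[sq_R1 F]_(n + n)) (A2 : 'M[sq_R2 F]_(n + n)),
    [/\ in_GL A1, in_GL A2 &
        block_mx A 0 0 B = map_mx (sq_h1 F) A1 *m map_mx (sq_h2 F) A2].

Section LocalizationSquare.
Variables (R R' : comPzRingType) (g : {rmorphism R -> R'}) (x : R).

Fact loc_square_comm (r : R) :
  loc_map g (to_loc x r) = to_loc (g x) (g r).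
Proof. exact: loc_mapE. Qed.

Definition loc_square : square :=
  @Square R (loc x) R' (loc (g x))
    (to_loc x) g (@loc_map R R' g x) (to_loc (g x)) loc_square_comm.

End LocalizationSquare.

Definition integral_domain (D : comPzRingType) : Prop :=
  (1 : D) <> 0 /\ forall a b : D, a * b = 0 -> a = 0 \/ b = 0.

Definition euclidean_domain (D : comPzRingType) : Prop :=
  integral_domain D /\
  exists N : D -> nat, forall a b : D, b <> 0 ->
  exists q r : D, a = b * q + r /\ (r = 0 \/ (N r < N b)%N).

(* The ring D again, as the [idomainType] from which the library builds its
   field of fractions. *)
Section DomainType.
Variables (D : comPzRingType) (domD : integral_domain D).

Definition domain_of of integral_domain D : Type := D.
Local Notation T := (domain_of domD).

HB.instance Definition _ := GRing.ComPzRing.copy T D.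

Fact domain_of_neq0 : (1 : T) != 0.
Proof. by apply/eqP; case: domD. Qed.

HB.instance Definition _ :=
  GRing.PzSemiRing_isNonZero.Build T domain_of_neq0.

Definition domain_of_unit (a : T) : bool := `[< exists b : T, b * a = 1 >].

Definition domain_of_inv (a : T) : T :=
  if pselect (exists b : T, b * a = 1) is left h then sval (cid h) else a.

Fact domain_of_mulV : {in domain_of_unit, left_inverse 1 domain_of_inv *%R}.
Proof.
move=> a /asboolP ha; rewrite /domain_of_inv; case: pselect => // h.
by case: cid.
Qed.

Fact domain_of_unitP (a b : T) : b * a = 1 -> domain_of_unit a.
Proof. by move=> h; apply/asboolP; exists b. Qed.

Fact domain_of_inv_out : {in [predC domain_of_unit], domain_of_inv =1 id}.
Proof.
move=> a /negP ha; rewrite /domain_of_inv; case: pselect => // h.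
by case: ha; apply/asboolP.
Qed.

HB.instance Definition _ := GRing.ComNzRing_hasMulInverse.Build T
  domain_of_mulV domain_of_unitP domain_of_inv_out.

Fact domain_of_integral : GRing.integral_domain_axiom T.
Proof.
move=> a b hab; have [_ /(_ a b hab)] := domD.
by case=> ->; rewrite eqxx ?orbT.
Qed.

HB.instance Definition _ :=
  GRing.ComUnitRing_isIntegral.Build T domain_of_integral.

Definition frac_field : fieldType := {fraction T}.

Definition to_frac (a : D) : frac_field := @FracField.tofrac T a.

End DomainType.

(* Main.v *)
(* (1) => (2): after clearing denominators, a matrix over R'_{g(x)} of
   determinant 1 has entries in R' and determinant u * g(x)^d with u a unit.
   If d > 0, it is singular modulo g(x), so its rows satisfy a nontrivial
   relation over R/(x), since R'/(g(x)) lies in the fraction field of R/(x).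
   Euclid's algorithm, lifted to invertible matrices over R, turns the relation
   into the vanishing of a single row, which can be divided by x; this lowers d.
   So every matrix of determinant 1 splits, in particular diag(A, A^-1).

   (2) => (1): patching the transvection with entry r / g(x) shows that the
   elements b of R for which r * g(b) comes from R modulo g(x) generate the unit
   ideal of R'. As R/(x) is principal, a single such b is a unit modulo g(x), and
   r becomes the fraction a / b. *)
Require Import Defs.
From HB Require Import structures.
From mathcomp Require Import all_boot ssralg zmodp matrix ring boolp.
From mathcomp Require Import generic_quotient ring_quotient fraction.

Set Implicit Arguments.
Unset Strict Implicit.
Unset Printing Implicit Defensive.

Import GRing.Theory.
Local Open Scope ring_scope.

(** * Invertible matrices and Euclidean reduction of rows *)

Lemma in_GL1 (R : comPzRingType) n : in_GL (1%:M : 'M[R]_n).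
Proof. by exists 1%:M; split; rewrite mulmx1. Qed.

Lemma in_GL_mul (R : comPzRingType) n (A B : 'M[R]_n) :
  in_GL A -> in_GL B -> in_GL (A *m B).
Proof.
move=> [A' [AA' A'A]] [B' [BB' B'B]]; exists (B' *m A'); split.
  by rewrite mulmxA -(mulmxA A) BB' mulmx1 AA'.
by rewrite mulmxA -(mulmxA B') A'A mulmx1 B'B.
Qed.

Lemma in_GL_scale (R : comPzRingType) n (a b : R) (A : 'M[R]_n) :
  a * b = 1 -> in_GL A -> in_GL (a *: A).
Proof.
move=> ab [B [AB BA]]; exists (b *: B).
by split; rewrite -scalemxAl -scalemxAr scalerA ?AB ?BA 1?[b * a]mulrC ab scale1r.
Qed.

Lemma inverse_mx_map (R S : comPzRingType) (f : {rmorphism R -> S}) n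
    (A B : 'M[R]_n) :
  inverse_mx A B -> inverse_mx (map_mx f A) (map_mx f B).
Proof. by move=> [AB BA]; split; rewrite -map_mxM ?AB ?BA map_mx1. Qed.

Lemma in_GL_map (R S : comPzRingType) (f : {rmorphism R -> S}) n (A : 'M[R]_n) :
  in_GL A -> in_GL (map_mx f A).
Proof. by move=> [B AB]; exists (map_mx f B); apply: inverse_mx_map. Qed.

Lemma inverse_mx_det (R : comPzRingType) n (A B : 'M[R]_n) :
  inverse_mx A B -> \det A * \det B = 1.
Proof. by move=> [AB _]; rewrite -det_mulmx AB det1. Qed.

Lemma in_GL_det (R : comPzRingType) n (A : 'M[R]_n) (v : R) :
  \det A * v = 1 -> in_GL A.
Proof.
move=> Av; exists (v *: \adj A); split.
  by rewrite -scalemxAr mul_mx_adj scale_scalar_mx mulrC Av.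
by rewrite -scalemxAl mul_adj_mx scale_scalar_mx mulrC Av.
Qed.

(** The product [c *m u] squares to zero, because [u *m c] appears in the middle of its square. *)
Lemma inverse_mx_transvection (R : comPzRingType) n (c : 'cV[R]_n) (u : 'rV[R]_n) :
  u *m c = 0 -> inverse_mx (1%:M - c *m u) (1%:M + c *m u).
Proof.
move=> uc; have cu2 : c *m u *m (c *m u) = 0.
  by rewrite mulmxA -(mulmxA c) uc mulmx0 mul0mx.
by split; rewrite ?mulmxBl ?mulmxBr ?mulmxDl ?mulmxDr !mul1mx ?mulmx1 cu2
  ?addr0 ?subr0 ?addrK ?subrK.
Qed.

(* The invertible matrix is taken over [R], since a unit of [D] need not lift
   to a unit of [R]. *)
Lemma euclid_reduction (R D : comPzRingType) (p : {rmorphism R -> D})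
    (p_surj : forall d, exists r, p r = d) (euclid : euclidean_domain D) m
    (w : 'rV[R]_m) :
  map_mx p w != 0 ->
  exists (E F : 'M[R]_m) i, [/\ inverse_mx E F, p ((w *m E) 0 i) != 0 &
    forall j, j != i -> p ((w *m E) 0 j) = 0].
Proof.
have [_ [N divN]] := euclid.
(* Induction on a bound [n] for the norm of the pivot, a nonzero entry [j]. *)
suff red n j (v : 'rV[R]_m) : (N (p (v 0%R j)) < n)%N -> p (v 0 j) != 0 ->
    exists (E F : 'M[R]_m) i, [/\ inverse_mx E F, p ((v *m E) 0 i) != 0 &
    forall k, k != i -> p ((v *m E) 0 k) = 0].
  move=> w0; have [j wj] : exists j, p (w 0 j) != 0.
    apply: contrapT => /forallNP wj; case/eqP: w0; apply/rowP => j.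
    by rewrite !mxE; apply/eqP/negbNE/negP/wj.
  exact: red (ltnSn _) wj.
elim: n j v => // n IHn j v ltn vj0.
have /choice[q hq] : forall k, exists q : R, p (v 0 k - v 0 j * q) = 0 \/
    (N (p (v 0 k - v 0 j * q)%R) < N (p (v 0%R j)))%N.
  move=> k.
  have [|q' [r [eqr hr]]] := divN (p (v 0 k)) (p (v 0 j)); first exact/eqP.
  have [q pq] := p_surj q'; exists q.
  by rewrite rmorphB rmorphM eqr pq addrC addKr.
(* Setting entry [j] of [u] to zero gives [u *m c = 0]: the column operation keeps the pivot and
   replaces every other entry by its remainder. *)
pose u : 'rV[R]_m := \row_k (if k == j then 0 else q k).
pose c : 'cV[R]_m := delta_mx j 0.
have uc : u *m c = 0 by apply/rowP => i; rewrite -colE !mxE eqxx.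
have invU := inverse_mx_transvection uc.
have vU k : (v *m (1%:M - c *m u)) 0 k = v 0 k - v 0 j * u 0 k.
  rewrite mulmxBr mulmx1 mulmxA -colE !mxE big_ord_recl big_ord0 addr0.
  by rewrite !mxE.
have vUj : (v *m (1%:M - c *m u)) 0 j = v 0 j.
  by rewrite vU mxE eqxx mulr0 subr0.
have vUk k : k != j -> (v *m (1%:M - c *m u)) 0 k = v 0 k - v 0 j * q k.
  by move=> kj; rewrite vU mxE (negbTE kj).
(* Either only the pivot survives in [D], or some nonzero remainder, of smaller norm, becomes the
   next pivot. *)
have [all0|] := pselect (forall k, k != j -> p ((v *m (1%:M - c *m u)) 0 k) = 0).
  by exists (1%:M - c *m u), (1%:M + c *m u), j; split; rewrite ?vUj.
move=> /existsNP[k /not_implyP[kj /eqP rk0]].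
have [|E [F [i [EF ci0 oi0]]]] := IHn k (v *m (1%:M - c *m u)) _ rk0.
  have [rk|ltr] := hq k; first by rewrite vUk // rk eqxx in rk0.
  by rewrite vUk //; apply: leq_trans ltr _.
have [UV VU] := invU; have [EF1 FE1] := EF.
exists ((1%:M - c *m u) *m E), (F *m (1%:M + c *m u)), i.
split; rewrite ?mulmxA //; split.
  by rewrite mulmxA -(mulmxA _ E) EF1 mulmx1.
by rewrite mulmxA -(mulmxA F) VU mulmx1.
Qed.

(** Column operations over [D] reduce [b] to a single nonzero entry. They preserve the relation with
    [a], and unimodularity then makes the image of that entry a unit. *)
Lemma fraction_of_unimodular (D D' : comPzRingType) (f : {rmorphism D -> D'})
    (euclid : euclidean_domain D) n (a b : 'rV[D]_n) (y : 'cV[D']_n) (r : D') :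
  (1 : D') <> 0 -> map_mx f a = r *: map_mx f b -> map_mx f b *m y = 1%:M ->
  exists a0 b0 y0, f a0 = r * f b0 /\ f b0 * y0 = 1.
Proof.
move=> D'1 fab fby.
have b0 : map_mx idfun b != 0.
  apply/eqP; rewrite map_mx_id // => b0; apply: D'1.
  by move/matrixP/(_ 0 0): fby; rewrite b0 map_mx0 mul0mx !mxE.
have [|E [F [i [[EF _] _ oi]]]] := @euclid_reduction D D idfun _ euclid n b b0.
  by move=> d; exists d.
exists ((a *m E) 0 i), ((b *m E) 0 i), ((map_mx f F *m y) i 0); split.
  have /matrixP/(_ 0 i) : map_mx f (a *m E) = r *: map_mx f (b *m E).
    by rewrite !map_mxM fab scalemxAl.
  by rewrite !mxE.
have : map_mx f (b *m E) *m (map_mx f F *m y) = 1%:M.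
  by rewrite mulmxA -map_mxM -mulmxA EF mulmx1.
move/matrixP/(_ 0 0); rewrite !mxE eqxx mulr1n (bigD1 i) //= big1 ?addr0 => [<-|j ji].
  by rewrite !mxE.
by rewrite mxE [_ j]oi // rmorph0 mul0r.
Qed.

(** * Fractions and embeddings into the fraction field *)

Lemma fraction_repr (T : idomainType) (q : {fraction T}) :
  exists a b : T, b != 0 /\ q * FracField.tofrac b = FracField.tofrac a.
Proof.
elim/quotW: q => z; exists z.1, z.2; split; first exact: denom_ratioP.
unlock FracField.tofrac; rewrite -[LHS]FracField.pi_mul; apply/eqP.
rewrite FracField.equivf_def /FracField.mulf !numden_Ratio ?mulf_neq0 ?oner_eq0 //.
all: by rewrite ?denom_ratioP // !mulr1 mulrC.
Qed.

Lemma common_denominator (T : idomainType) m (v : 'rV[{fraction T}]_m) :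
  exists (d : T) (w : 'rV[T]_m), d != 0 /\
    map_mx (@FracField.tofrac T) w = FracField.tofrac d *: v.
Proof.
have /choice[ab hab] : forall i, exists ab : T * T,
    ab.2 != 0 /\ v 0 i * FracField.tofrac ab.2 = FracField.tofrac ab.1.
  by move=> i; have [a [b hab]] := fraction_repr (v 0 i); exists (a, b).
exists (\prod_i (ab i).2), (\row_i ((ab i).1 * \prod_(j | j != i) (ab j).2)).
split; first by apply/prodf_neq0 => i _; case: (hab i).
apply/rowP => i; rewrite !mxE [X in _ = FracField.tofrac X * _](bigD1 i) //=.
by rewrite !tofracM; case: (hab i) => _ <-; ring.
Qed.

Section FractionEmbedding.
Variables (D D' : comPzRingType) (domD : integral_domain D).
Variable f : {rmorphism D -> D'}.
Local Notation T := (domain_of domD).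
Local Notation K := (frac_field domD).
Local Notation tofrac := (@FracField.tofrac T).

(** Linear algebra over the field [K] gives a null row. Clearing its denominators brings it into
    [D], and injectivity of [iota] brings the relation back to [D']. *)
Lemma null_row_of_det0 (iota : {rmorphism D' -> K}) m (M : 'M[D']_m) :
  injective iota -> (forall u, iota (f u) = to_frac domD u) -> \det M = 0 ->
  exists2 w : 'rV[D]_m, w != 0 & map_mx f w *m M = 0.
Proof.
move=> iota_inj iota_f detM.
have [v v0 vM] : exists2 v : 'rV[K]_m, v != 0 & v *m map_mx iota M = 0.
  by apply/det0P; rewrite det_map_mx detM rmorph0.
have [d [w [d0 wE]]] := common_denominator v.
exists (w : 'rV[D]_m).
  apply: contraNneq v0 => w0; move: wE; rewrite (w0 : w = 0) map_mx0 => /esym/eqP.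
  by rewrite scalemx_eq0 tofrac_eq0 (negbTE d0).
have iM : map_mx iota (map_mx f (w : 'rV[D]_m) *m M) = 0.
  rewrite map_mxM -map_mx_comp.
  have -> : map_mx (iota \o f) (w : 'rV[D]_m) = map_mx tofrac w.
    by apply/rowP => i; rewrite !mxE /= iota_f.
  by rewrite wE -scalemxAl vM scaler0.
apply/matrixP => i j; apply: iota_inj.
by move/matrixP/(_ i j): iM; rewrite mxE => ->; rewrite !mxE rmorph0.
Qed.

Lemma fraction_embedding (f_inj : injective f) :
  (forall u, exists a b y, f a = u * f b /\ f b * y = 1) ->
  exists iota : {rmorphism D' -> K},
    injective iota /\ forall u, iota (f u) = to_frac domD u.
Proof.
move=> fracs.
have D'1 : (1 : D') <> 0.
  by rewrite -(rmorph1 f) -(rmorph0 f) => /f_inj; case: domD.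
pose rep u (ab : T * T) := f ab.1 = u * f ab.2 /\ exists y, f ab.2 * y = 1.
have /choice[ab hab] : forall u, exists ab, rep u ab.
  move=> u; have [a [b [y [e1 e2]]]] := fracs u.
  by exists (a, b); split=> //; exists y.
pose iota u : K := tofrac (ab u).1 / tofrac (ab u).2.
have ab0 u : (ab u).2 != 0.
  apply/eqP => b0; have [_ [y]] := hab u.
  by rewrite b0 rmorph0 mul0r => /esym.
(* Any representation of [u] with nonzero denominator computes [iota u], so the morphism laws only
   require exhibiting suitable numerators and denominators. *)
have iotaE u (a b : T) : b != 0 -> f a = u * f b -> iota u = tofrac a / tofrac b.
  move=> b0 fab; apply/eqP; rewrite eqr_div ?tofrac_eq0 // -!rmorphM tofrac_eq.
  apply/eqP/f_inj; rewrite !rmorphM fab; case: (hab u) => -> _; ring.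
have iota_zmod : zmod_morphism iota.
  move=> u v; have [fu _] := hab u; have [fv _] := hab v.
  rewrite (iotaE _ ((ab u).1 * (ab v).2 - (ab v).1 * (ab u).2)
    ((ab u).2 * (ab v).2)) ?mulf_neq0 //.
    rewrite rmorphB !rmorphM /= -[in RHS]mulNr addf_div ?tofrac_eq0 //.
    by rewrite mulNr.
  by rewrite rmorphB !rmorphM fu fv; ring.
have iota_monoid : monoid_morphism iota.
  split=> [|u v].
    by rewrite (iotaE _ 1 1) ?oner_eq0 // ?rmorph1 ?mulr1 ?divr1.
  have [fu _] := hab u; have [fv _] := hab v.
  rewrite (iotaE _ ((ab u).1 * (ab v).1) ((ab u).2 * (ab v).2)) ?mulf_neq0 //.
    by rewrite !rmorphM /= mulf_div.
  by rewrite !rmorphM fu fv; ring.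
pose iM : {rmorphism D' -> K} := HB.pack iota
  (GRing.isZmodMorphism.Build _ _ iota iota_zmod)
  (GRing.isMonoidMorphism.Build _ _ iota iota_monoid).
exists iM; split=> [|u].
  apply: raddf_inj => u /= /eqP.
  rewrite mulf_eq0 invr_eq0 !tofrac_eq0 (negbTE (ab0 u)) orbF => /eqP a0.
  have [fu [y fy]] := hab u; rewrite a0 rmorph0 in fu.
  by rewrite -[u]mulr1 -fy mulrA -fu mul0r.
rewrite /= (iotaE _ u 1) ?oner_eq0 // ?rmorph1 ?mulr1 //.
by rewrite divr1.
Qed.

End FractionEmbedding.

(** * Localization at a non-zero-divisor and the cartesian property *)

Lemma nzd_exp_inj (R : comPzRingType) (x : R) (k : nat) (a b : R) :
  non_zero_divisor x -> x ^+ k * a = x ^+ k * b -> a = b.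
Proof.
move=> nzd; elim: k => [|k IHk]; first by rewrite !mul1r.
rewrite exprS -!mulrA => /eqP; rewrite -subr_eq0 -mulrBr => /eqP/nzd/eqP.
by rewrite subr_eq0 => /eqP.
Qed.

Lemma to_loc_inj (R : comPzRingType) (x : R) :
  non_zero_divisor x -> injective (to_loc x).
Proof.
move=> nzd a b /loc_frac_eqP[k]; rewrite !expr0 !mulr1.
exact: nzd_exp_inj.
Qed.

Lemma to_loc_expM (R : comPzRingType) (x a : R) (n : nat) :
  to_loc x (x ^+ n) * loc_frac x a n = to_loc x a.
Proof.
rewrite /to_loc loc_fracM; apply/loc_frac_eqP; exists 0%N.
by rewrite expr0; ring.
Qed.

Lemma to_loc_mx (R : comPzRingType) (x : R) m n (A : 'M[loc x]_(m, n)) :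
  exists (k : nat) (M : 'M[R]_(m, n)),
    to_loc x (x ^+ k) *: A = map_mx (to_loc x) M.
Proof.
have /choice[an han] : forall ij : 'I_m * 'I_n, exists an : R * nat,
    A ij.1 ij.2 = loc_frac x an.1 an.2.
  by move=> [i j] /=; elim/loc_fracW: (A i j) => a k; exists (a, k).
pose k := \max_ij (an ij).2.
exists k, (\matrix_(i, j) (x ^+ (k - (an (i, j)).2) * (an (i, j)).1)).
apply/matrixP => i j; rewrite !mxE (han (i, j)) /=.
have le_k : ((an (i, j)).2 <= k)%N by rewrite /k; exact: leq_bigmax (i, j).
by rewrite -{1}(subnK le_k) exprD !rmorphM -mulrA to_loc_expM.
Qed.

Lemma to_pquot_eq0 (R : comPzRingType) (x a : R) :
  to_pquot x a = 0 <-> exists c, a = x * c.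
Proof. by rewrite -(rmorph0 (to_pquot x)) to_pquot_eqP subr0. Qed.

Lemma to_pquot_surj (R : comPzRingType) (x : R) (u : pquot x) :
  exists r, to_pquot x r = u.
Proof. by elim/to_pquotW: u => a; exists a. Qed.

(** Powers of [x] are removed one at a time: [g a] vanishes modulo [g x], hence [a] is divisible by
    [x] by injectivity. *)
Lemma pquot_map_loc_pullback (R R' : comPzRingType) (g : {rmorphism R -> R'}) (x : R)
    (gx_nzd : non_zero_divisor (g x)) (n : nat) (a : R) (s : R') :
  injective (@pquot_map R R' g x) -> g a = g x ^+ n * s ->
  exists2 r, a = x ^+ n * r & g r = s.
Proof.
move=> inj_g; elim: n a s => [|n IHn] a s gas.
  by exists a; rewrite ?gas mul1r.
have [c ac] : exists c, a = x * c.
  apply/to_pquot_eq0/inj_g; rewrite rmorph0 pquot_mapE; apply/to_pquot_eq0.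
  by exists (g x ^+ n * s); rewrite gas exprS mulrA.
have [|r cr grs] := IHn c s; last by exists r => //; rewrite ac cr exprS mulrA.
apply: (@nzd_exp_inj _ (g x) 1) => //.
by rewrite expr1 -rmorphM -ac gas exprS mulrA.
Qed.

Lemma cartesian_loc_square (R R' : comPzRingType) (g : {rmorphism R -> R'}) (x : R)
    (x_nzd : non_zero_divisor x) (gx_nzd : non_zero_divisor (g x)) :
  injective (@pquot_map R R' g x) -> cartesian (loc_square g x).
Proof.
move=> inj_g; split; first by move=> a b [/(to_loc_inj x_nzd)].
move=> [l s]; split=> [/eqP|[r <-]]; last first.
  by rewrite /sq_psi /= loc_square_comm subrr.
rewrite /sq_psi /= subr_eq0; elim/loc_fracW: l => a n /eqP.
rewrite loc_mapE => /loc_frac_eqP[k]; rewrite expr0 mulr1.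
move=> /(nzd_exp_inj gx_nzd); rewrite mulrC => gas.
have [r ar grs] := pquot_map_loc_pullback gx_nzd inj_g gas.
exists r; rewrite /sq_phi /= grs ar; congr (_, _).
by apply/loc_frac_eqP; exists 0%N; rewrite expr0 !mul1r mulr1 mulrC.
Qed.

(** * Factorization of matrices over the localization *)

Definition dilation (S : pzRingType) m (i : 'I_m) (s : S) : 'M[S]_m :=
  diag_mx (\row_j (if j == i then s else 1)).

Lemma det_dilation (S : comPzRingType) m (i : 'I_m) (s : S) :
  \det (dilation i s) = s.
Proof.
rewrite det_diag (bigD1 i) //= mxE eqxx big1 ?mulr1 // => j ji.
by rewrite mxE (negbTE ji).
Qed.

Lemma map_dilation (S S' : pzRingType) (f : {rmorphism S -> S'}) m (i : 'I_m) s :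
  map_mx f (dilation i s) = dilation i (f s).
Proof.
rewrite map_diag_mx; congr diag_mx; apply/rowP => j; rewrite !mxE.
by case: eqP => // _; rewrite rmorph1.
Qed.

Lemma in_GL_dilation (R : comPzRingType) (x : R) m (i : 'I_m) : in_GL (dilation i (to_loc x x)).
Proof.
apply: (@in_GL_det _ _ _ (loc_frac x 1 1)).
by rewrite det_dilation (to_loc_expM x 1 1 : to_loc x x * _ = _) rmorph1.
Qed.

Section Patching.
Variables (R R' : comPzRingType) (g : {rmorphism R -> R'}) (x : R).
Hypothesis gx_nzd : non_zero_divisor (g x).
Hypothesis euclid : euclidean_domain (pquot x).
Variable iota : {rmorphism pquot (g x) -> frac_field (proj1 euclid)}.
Hypothesis iota_inj : injective iota.
Hypothesis iotaE :
  forall u, iota (@pquot_map R R' g x u) = to_frac (proj1 euclid) u.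
Local Notation tl := (to_loc (g x)).

(* Clearing a row: modulo [g x] the rows of [M] are dependent over [R / x],
   and a Euclidean reduction of the relation makes one row vanish. *)
Lemma split_dilation m (M : 'M[R']_m) (c : R') :
  \det M = g x * c ->
  exists (E : 'M[R]_m) i (N : 'M[R']_m),
    in_GL E /\ M = map_mx g E *m (dilation i (g x) *m N).
Proof.
move=> detM; have detM0 : \det (map_mx (to_pquot (g x)) M) = 0.
  by rewrite det_map_mx detM; apply/to_pquot_eq0; exists c.
have [w w0 wM] := null_row_of_det0 iota_inj iotaE detM0.
have /choice[w' hw'] := fun j => to_pquot_surj (w 0 j).
have wE : map_mx (to_pquot x) (\row_j w' j) = w.
  by apply/rowP => j; rewrite !mxE hw'.
rewrite -wE in w0 wM.
have [E [F [i [EF wEi wEj]]]] := euclid_reduction (@to_pquot_surj R x) euclid w0.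
have [v vE] : exists v, v = \row_j w' j *m E by eexists.
have [L LE] : exists L, L = map_mx g F *m M by eexists.
rewrite -vE in wEi wEj.
(* Modulo [g x], the row [v] annihilates [L], and only its entry [i] is nonzero. After [iota], that
   entry can be cancelled in a field. *)
have row0 j : to_pquot (g x) (L i j) = 0.
  have : map_mx (@pquot_map R R' g x) (map_mx (to_pquot x) v)
      *m map_mx (to_pquot (g x)) L = 0.
    have -> : map_mx (to_pquot (g x)) L = map_mx (@pquot_map R R' g x)
        (map_mx (to_pquot x) F) *m map_mx (to_pquot (g x)) M.
      rewrite LE map_mxM; congr (_ *m _).
      by apply/matrixP => p q; rewrite !mxE pquot_mapE.
    by rewrite vE mulmxA -map_mxM -map_mxM -mulmxA (proj1 EF) mulmx1 wM.
  move/matrixP/(_ 0 j); rewrite mxE [RHS]mxE (bigD1 i) //= big1 => [|k ki].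
    rewrite addr0 !mxE => /(congr1 iota); rewrite rmorphM iotaE rmorph0.
    move=> /eqP; rewrite mulf_eq0 tofrac_eq0 => /orP[vi0|].
      by case/negP: wEi.
    by move=> /eqP; rewrite -[X in _ = X](rmorph0 iota) => /iota_inj.
  by rewrite !mxE wEj // rmorph0 mul0r.
have /choice[y hy] := fun j => (to_pquot_eq0 (g x) (L i j)).1 (row0 j).
(* [N] is [L] with row [i] divided by [g x]. *)
exists E, i, (\matrix_(p, q) (if p == i then y q else L p q)).
split; first by exists F.
rewrite -[M]mul1mx -(map_mx1 g) -(proj1 EF) map_mxM -mulmxA -LE; congr (_ *m _).
apply/matrixP => p q; rewrite mul_diag_mx !mxE.
by case: eqP => [->|_]; rewrite ?mul1r.
Qed.

(** Induction on [d]: each step strips one dilation off [M], which [A1] absorbs because [x] is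
    invertible in [loc x]. For [d = 0] the matrix [M] is itself invertible. The unit [u] varies
    because [E] changes the determinant by a unit. *)
Lemma split_patching d m (M : 'M[R']_m) (u v : R') :
  u * v = 1 -> \det M = u * g x ^+ d ->
  exists (A1 : 'M[loc x]_m) (A2 : 'M[R']_m),
    [/\ in_GL A1, in_GL A2 &
        map_mx tl M = map_mx (@loc_map R R' g x) A1 *m map_mx tl A2].
Proof.
elim: d m M u v => [|d IHd] m M u v uv detM.
  exists 1%:M, M; split; first exact: in_GL1.
    by apply: (@in_GL_det _ _ _ v); rewrite detM mulr1.
  by rewrite map_mx1 mul1mx.
have [|E [i [N [[F EF] MN]]]] := @split_dilation m M (u * g x ^+ d).
  by rewrite detM exprS mulrCA.
have detEF : g (\det E) * g (\det F) = 1.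
  by rewrite -rmorphM (inverse_mx_det EF) rmorph1.
have detN : \det N = (g (\det F) * u) * g x ^+ d.
  apply: (@nzd_exp_inj _ (g x) 1) => //; rewrite expr1.
  have detE : g (\det E) * (g x * \det N) = u * g x ^+ d.+1.
    by rewrite -detM MN !det_mulmx det_map_mx det_dilation.
  transitivity (g (\det F) * (g (\det E) * (g x * \det N))).
    by rewrite -[LHS]mul1r -detEF; ring.
  by rewrite detE exprS; ring.
have [|A1 [A2 [GA1 GA2 NA]]] := IHd m N _ (v * g (\det E)) _ detN.
  by rewrite mulrACA [X in X * _]mulrC; rewrite -uv -[RHS]mulr1 -detEF; ring.
exists (map_mx (to_loc x) E *m (dilation i (to_loc x x) *m A1)), A2; split=> //.
  apply: in_GL_mul; first by apply: in_GL_map; exists F.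
  by apply: in_GL_mul => //; apply: in_GL_dilation.
rewrite MN !map_mxM NA !mulmxA !map_dilation /= loc_square_comm; congr (_ *m _ *m _ *m _).
by apply/matrixP => p q; rewrite !mxE loc_square_comm.
Qed.

Lemma strong_patching_loc m (A : 'M[loc (g x)]_m) :
  \det A = 1 ->
  exists (A1 : 'M[loc x]_m) (A2 : 'M[R']_m),
    [/\ in_GL A1, in_GL A2 &
        A = map_mx (@loc_map R R' g x) A1 *m map_mx tl A2].
Proof.
move=> detA; have [k [M kA]] := to_loc_mx A.
have detM : \det M = 1 * g x ^+ (k * m).
  apply: (to_loc_inj gx_nzd); rewrite -det_map_mx -kA detZ detA mulr1 mul1r.
  rewrite exprM; by elim: (m) => [|j IHj]; rewrite ?expr0 ?rmorph1 // !exprS rmorphM IHj.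
have [A1 [A2 [GA1 GA2 MA]]] := split_patching (mulr1 1) detM.
(* The power of [g x] used to clear denominators is the image of a unit of [loc x], so the first
   factor takes it back. *)
exists (loc_frac x 1 k *: A1), A2; split=> //.
  apply: (in_GL_scale _ GA1 (b := to_loc x (x ^+ k))).
  by rewrite mulrC to_loc_expM rmorph1.
rewrite map_mxZ /= loc_mapE rmorph1 -scalemxAl -MA -kA scalerA mulrC to_loc_expM.
by rewrite rmorph1 scale1r.
Qed.

End Patching.

(** * From patching to fractions *)

Section Converse.
Variables (R R' : comPzRingType) (g : {rmorphism R -> R'}) (x : R).
Hypothesis x_nzd : non_zero_divisor x.
Hypothesis cart : cartesian (loc_square g x).

Lemma cartesian_pullback (l : loc x) (s : R') :
  loc_map g l = to_loc (g x) s -> exists2 r, to_loc x r = l & g r = s.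
Proof.
move=> ls; have [_ /(_ (l, s))[+ _]] := cart.
by case=> [|r [rl rs]]; [rewrite /sq_psi /= ls subrr | exists r].
Qed.

(** If [g a = g x * c], then [a / x] and [c] agree in [loc (g x)]; the element of [R] they come from
    is the quotient of [a] by [x]. *)
Lemma cartesian_pquot_map_inj : injective (@pquot_map R R' g x).
Proof.
apply: raddf_inj; elim/to_pquotW=> a; rewrite /= pquot_mapE.
move=> /to_pquot_eq0[c gac]; apply/to_pquot_eq0.
have [|r ra _] := @cartesian_pullback (loc_frac x a 1) c.
  rewrite loc_mapE; apply/loc_frac_eqP; exists 0%N.
  by rewrite expr0 expr1 gac !mul1r mulr1 mulrC.
exists r; apply: (to_loc_inj x_nzd); rewrite rmorphM /= ra.
by rewrite (to_loc_expM x a 1 : to_loc x x * _ = _).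
Qed.

(* Patching the transvection with entry [r / g x] gives a row [b] over [R],
   unimodular over [R'], such that [r * g b] comes from [R] modulo [g x]. *)
Lemma patching_denominators (r : R') :
  strong_milnor_patching (loc_square g x) ->
  exists n (a b : 'rV[R]_n) (y : 'cV[R']_n),
    map_mx g b *m y = 1%:M /\
    exists c, map_mx g a = r *: map_mx g b + g x *: c.
Proof.
move=> [_ patch]; pose c : 'cV[loc (g x)]_2 := delta_mx 0 0.
pose u : 'rV[loc (g x)]_2 := loc_frac (g x) r 1 *: delta_mx 0 1.
have uc : u *m c = 0 by rewrite /u /c -scalemxAl mul_delta_mx_0 ?scaler0.
have [UV VU] := inverse_mx_transvection uc.
have [||A1 [A2 [_ [C [A2C CA2]] eA]]] :=
  patch 2%N (1%:M + c *m u) (1%:M - c *m u) => //.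
(* Multiplying by [C], the inverse of [A2], leaves matrices over [loc x] and [R'] whose rows can be
   compared. *)
have {}eA : block_mx (1%:M + c *m u) 0 0 (1%:M - c *m u) *m map_mx (to_loc (g x)) C
    = map_mx (@loc_map R R' g x) A1.
  by rewrite eA /= -mulmxA -map_mxM A2C map_mx1 mulmx1.
pose i0 : 'I_(2 + 2) := lshift 2 0; pose i1 : 'I_(2 + 2) := lshift 2 1.
have eU : usubmx (map_mx (@loc_map R R' g x) A1) =
    map_mx (to_loc (g x)) (usubmx C) + c *m (u *m map_mx (to_loc (g x)) (usubmx C)).
  rewrite -eA -{1}[C]vsubmxK map_col_mx mul_block_col col_mxKu mul0mx addr0.
  by rewrite mulmxDl mul1mx mulmxA.
have uE j : (u *m map_mx (to_loc (g x)) (usubmx C)) 0 j =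
    loc_frac (g x) r 1 * to_loc (g x) (C i1 j).
  by rewrite /u -scalemxAl -rowE !mxE.
(* The transvection fixes row [i1], so this row of [C] agrees with that of [A1] and comes from
   [R]. *)
have e1 j : loc_map g (A1 i1 j) = to_loc (g x) (C i1 j).
  move/matrixP/(_ 1 j): eU.
  by rewrite !mxE big_ord_recl big_ord0 !mxE /= mul0r !addr0.
have e0 j : loc_map g (A1 i0 j) =
    to_loc (g x) (C i0 j) + loc_frac (g x) r 1 * to_loc (g x) (C i1 j).
  move/matrixP/(_ 0 j): eU.
  by rewrite !mxE big_ord_recl big_ord0 uE !mxE /= mul1r addr0.
have /choice[b hb] j : exists b, g b = C i1 j.
  by have [b _ hb] := cartesian_pullback (e1 j); exists b.
(* Row [i0] contains the denominator [g x]; multiplying by [x] clears it, so this row also comes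
   from [R]. *)
have /choice[a ha] j : exists a, g a = r * C i1 j + g x * C i0 j.
  have [|a _ ha] := @cartesian_pullback (to_loc x x * A1 i0 j)
    (r * C i1 j + g x * C i0 j); last by exists a.
  rewrite rmorphM /= loc_square_comm e0 rmorphD !rmorphM mulrDr mulrA.
  by rewrite (to_loc_expM (g x) r 1 : to_loc (g x) (g x) * _ = _) addrC.
(* Unimodularity of [b] is the diagonal entry [i1] of [C *m A2 = 1]. *)
exists 4%N, (\row_j a j), (\row_j b j), (col i1 A2); split.
  apply/matrixP => p q; rewrite !ord1; move/matrixP/(_ i1 i1): CA2.
  by rewrite !mxE eqxx => <-; apply: eq_bigr => j _; rewrite !mxE hb.
by exists (row i0 C); apply/rowP => j; rewrite !mxE ha hb.
Qed.

End Converse.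

Theorem theorem1p7 (R R' : comPzRingType) (g : {rmorphism R -> R'}) (x : R)
    (x_nzd : non_zero_divisor x) (gx_nzd : non_zero_divisor (g x))
    (euclid : euclidean_domain (pquot x)) :
  (injective (@pquot_map R R' g x) /\
   exists iota : {rmorphism pquot (g x) -> frac_field (proj1 euclid)},
     injective iota /\
     forall u : pquot x,
       iota (@pquot_map R R' g x u) = to_frac (proj1 euclid) u)
  <->
  strong_milnor_patching (loc_square g x).
Proof.
split=> [[inj_g [iota [iota_inj iotaE]]]|patching].
  split; first exact: cartesian_loc_square.
  move=> n A B _ AB; apply: (strong_patching_loc gx_nzd iota_inj iotaE).
  by rewrite det_lblock (inverse_mx_det AB).
have cart := proj1 patching; have inj_g := cartesian_pquot_map_inj x_nzd cart.
split=> //; apply: fraction_embedding => //; elim/to_pquotW=> r.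
have [n [a [b [y [by1 [c ac]]]]]] := patching_denominators cart r patching.
apply: (@fraction_of_unimodular _ _ (@pquot_map R R' g x) euclid n
  (map_mx (to_pquot x) a) (map_mx (to_pquot x) b) (map_mx (to_pquot (g x)) y)).
- have [+ _] := proj1 euclid => D1 /= D'1; apply/D1/inj_g.
  by rewrite rmorph1 rmorph0.
(* The error term [g x *: c] vanishes modulo [g x], leaving an exact proportionality. *)
- apply/rowP => j; move/rowP/(_ j)/(congr1 (to_pquot (g x))): ac.
  rewrite !mxE /= !pquot_mapE => ->; rewrite rmorphD rmorphM /= -[RHS]addr0; congr (_ + _).
  by apply/to_pquot_eq0; eexists.
have -> : map_mx (@pquot_map R R' g x) (map_mx (to_pquot x) b) =
    map_mx (to_pquot (g x)) (map_mx g b).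
  by apply/rowP => j; rewrite !mxE pquot_mapE.
by rewrite -map_mxM by1 map_mx1.
Qed.
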